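(* Let $(\eta^L(t))_{t\ge0}$ be the GRBB process on $L$ sites in which $B^{L,q}$ follows the Fermi-Dirac statistics with $L$ sites and $(1-q(\{0\}))L$ particles. Let $\eta^L(0)\in\mathbb{Z}_+^L$ be an initial configuration such that $$N:=\sum_{x=1}^L\eta^L_x(0)\in[2,L/2].$$ Then $(\eta^L(t))_{t\ge0}$ is ergodic and its invariant measure $\pi^{N,L}$ is the Fermi-Dirac distribution with $L$ sites and $N$ particles. Furthermore $$t_{\mathrm{mix}}:=\inf\Big\{t\ge0\colon\Vert\mathbb{P}(\eta^L(t)\in\cdot)-\pi^{N,L}\Vert\le 1/4\Big\}\le 13-4L\log\Big(1-\frac{N-1}{L}\Big),$$ where $\mathbb{P}(\eta^L(t)\in\cdot)$ is the distribution of $\eta^L(t)$.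
   Context: $\mathbb{Z}_+$ is the set of non-negative integers, and time $t$ ranges over $\mathbb{Z}_+$. The total variation distance between probability measures on a denumerable set $S$ is $\Vert p-q\Vert:=\sup_{A\subseteq S}(p(A)-q(A))=\frac12\sum_{s\in S}|p(\{s\})-q(\{s\})|$. Let $\rho_L(\xi):=\frac1L\sum_{x=1}^L\delta_{\xi_x}$ be the empirical measure of $\xi\in\mathbb{Z}_+^L$ and $w^L(\xi):=(\mathbf{1}(\xi_1>0),\dots,\mathbf{1}(\xi_L>0))$. The GRBB process $(\eta^L(t))_{t\ge0}$ is the discrete-time Markov chain on $\mathbb{Z}_+^L$ such that, if $\eta^L(t)=\xi$ and $q:=\rho_L(\xi)$, then $\eta^L(t+1)=\xi-w^L(\xi)+B^{L,q}$, where $B^{L,q}$ is a random vector in $\mathbb{Z}_+^L$ of given distribution, generated independently of everything else at each time step. Note that $(1-q(\{0\}))L$ is the number of $x$ with $\xi_x>0$. A random vector $X=(X_1,\dots,X_L)$ follows the Fermi-Dirac statistics (distribution) with $L$ sites and $m\le L$ particles if $\mathbb{P}(X_1=x_1,\dots,X_L=x_L)=1/\binom{L}{m}$ when $(x_1,\dots,x_L)\in\{0,1\}^L$ and $\sum_{k=1}^L x_k=m$, and $0$ otherwise. The dynamics conserves the total number of particles, so the chain is considered on configurations with $N$ particles. ''Ergodic'' means that on this set of configurations the chain has a unique invariant probability measure, to which the law of the chain converges as $t\to\infty$ from every initial configuration. *)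

(* Defs.v *)
From HB Require Import structures.
From mathcomp Require Import all_boot all_order all_algebra.
From mathcomp Require Import all_classical all_reals all_analysis.
From mathcomp Require Import measurable_realfun.

Set Implicit Arguments.
Unset Strict Implicit.
Unset Printing Implicit Defensive.

Import Order.TTheory GRing.Theory Num.Theory.
Import numFieldNormedType.Exports.

Local Open Scope classical_set_scope.
Local Open Scope ring_scope.

(* Configurations are L-tuples of natural numbers with the library's product
   sigma-algebra, which is the power set. *)
Section config_measurable.
Variable L : nat.

Lemma measurable_config (A : set (L.-tuple nat)) : measurable A.
Proof.
apply: countable_measurable => [t|]; last exact: countableP.
rewrite (_ : [set t] =
    \bigcap_(i in [set: 'I_L]) ((@tnth L nat)^~ i @^-1` [set tnth t i])).
  apply: fin_bigcap_measurable => // i _.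
  by rewrite -[X in measurable X]setTI; exact: measurable_tnth.
apply/seteqP; split=> [x -> //|x xt].
by apply: eq_from_tnth => i; exact: (xt i).
Qed.

Lemma measurable_fun_config d (T : measurableType d) (f : L.-tuple nat -> T) :
  measurable_fun [set: L.-tuple nat] f.
Proof. by move=> _ A _; exact: measurable_config. Qed.

End config_measurable.

Section markov_chains.
Local Open Scope ereal_scope.

Section kernel_power.
Context d (S : measurableType d) (R : realType).

Definition pkcomp (k1 k2 : R.-pker S ~> S) : S -> {measure set S -> \bar R} :=
  mkcomp_noparam k1 k2.

Section pkcomp_kernel.
Variables k1 k2 : R.-pker S ~> S.

HB.instance Definition _ := isKernel.Build _ _ _ _ _ (pkcomp k1 k2)
  (measurable_kernel (mkcomp_noparam k1 k2)).

Let pkcomp_prob x : pkcomp k1 k2 x [set: S] = 1.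
Proof.
rewrite /pkcomp /mkcomp_noparam /= /kcomp_noparam.
under eq_integral do rewrite prob_kernel.
by rewrite integral_cst// mul1e prob_kernel.
Qed.

HB.instance Definition _ :=
  Kernel_isProbability.Build _ _ _ _ _ (pkcomp k1 k2) pkcomp_prob.

End pkcomp_kernel.

(* kernel_power K t x is the law at time t of the chain started at x *)
Fixpoint kernel_power (K : R.-pker S ~> S) (t : nat) : R.-pker S ~> S :=
  if t is t'.+1 then pkcomp (kernel_power K t') K
  else kdirac (@measurable_id _ S setT).

End kernel_power.

Section total_variation_distance.
Context d (S : measurableType d) (R : realType).

Definition tv_dist (p q : {measure set S -> \bar R}) : R :=
  sup [set (fine (p A) - fine (q A))%R | A in [set: set S]].

End total_variation_distance.

Section ergodicity.
Context d (S : measurableType d) (R : realType) (K : R.-pker S ~> S).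

Definition invariant_on (E : set S) (pi : probability S R) : Prop :=
  pi E = 1 /\ forall A, measurable A -> \int[pi]_x K x A = pi A.

Definition ergodic_on (E : set S) : Prop :=
  exists pi : probability S R,
    [/\ invariant_on E pi,
        forall pi' : probability S R, invariant_on E pi' ->
          forall A, measurable A -> pi' A = pi A &
        forall x, E x -> tv_dist (kernel_power K t x) pi @[t --> \oo] --> 0%R].

End ergodicity.

Section configuration_processes.
Context d (Omega : measurableType d) (R : realType) (P : probability Omega R).
Variable L : nat.

Definition markov_chain (K : R.-pker (L.-tuple nat) ~> (L.-tuple nat))
    (X : nat -> {RV P >-> L.-tuple nat}) : Prop :=
  forall (t : nat) (h : nat -> L.-tuple nat) (A : set (L.-tuple nat)),
    let past := [set w | forall s, (s <= t)%N -> X s w = h s] in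
    P (past `&` X t.+1 @^-1` A) = P past * K (h t) A.

Definition mixing_time (X : nat -> {RV P >-> L.-tuple nat})
    (pi : probability (L.-tuple nat) R) : \bar R :=
  ereal_inf [set t%:R%:E | t in
    [set t : nat | (tv_dist (distribution P (X t)) pi <= 4^-1)%R]].

End configuration_processes.

End markov_chains.
Arguments markov_chain {d Omega R} P {L} K X.
Arguments mixing_time {d Omega R} P {L} X pi.


Section fermi_dirac.
Context {R : realType} (L m : nat).

Definition fermi_dirac_pmf (x : L.-tuple nat) : R :=
  if all (fun k => k <= 1)%N x && (sumn x == m) then 'C(L, m)%:R^-1 else 0.

(* The value for m > L is a dummy making fermi_dirac total. *)
Definition fermi_dirac (A : set (L.-tuple nat)) : \bar R :=
  if (m <= L)%N then \esum_(x in A) (fermi_dirac_pmf x)%:E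
  else \d_([tuple 0%N | _ < L]) A.

Lemma fermi_dirac_pmf_ge0 x : 0 <= fermi_dirac_pmf x.
Proof. by rewrite /fermi_dirac_pmf; case: ifP => // _; rewrite invr_ge0. Qed.

Let pmf_ge0 x : (0 <= (fermi_dirac_pmf x)%:E)%E.
Proof. by rewrite lee_fin fermi_dirac_pmf_ge0. Qed.

Let fermi_dirac0 : fermi_dirac set0 = 0%E.
Proof. by rewrite /fermi_dirac; case: ifP; rewrite ?esum_set0. Qed.

Let fermi_dirac_ge0 A : (0 <= fermi_dirac A)%E.
Proof. by rewrite /fermi_dirac; case: ifP => // _; exact: esum_ge0. Qed.

Let fermi_dirac_sigma_additive : semi_sigma_additive fermi_dirac.
Proof.
move=> F mF tF mUF; rewrite /fermi_dirac; case: ifP => mL; last first.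
  exact: measure_semi_sigma_additive.
apply: cvg_toP.
  by apply: is_cvg_ereal_nneg_natsum => k _; exact: esum_ge0.
by rewrite -nneseries_sum_bigcup.
Qed.

HB.instance Definition _ := isMeasure.Build _ _ _ fermi_dirac
  fermi_dirac0 fermi_dirac_ge0 fermi_dirac_sigma_additive.

Let indicator (A : {set 'I_L}) : L.-tuple nat := [tuple (i \in A : nat) | i < L].

Let sumn_indicator A : sumn (indicator A) = #|A|.
Proof.
rewrite sumnE big_tuple -sum1_card [RHS]big_mkcond /=.
by apply: eq_bigr => i _; rewrite tnth_mktuple; case: (i \in A).
Qed.

Let fermi_dirac_setT : fermi_dirac [set: L.-tuple nat] = 1%E.
Proof.
rewrite /fermi_dirac; case: ifP => mL; last by rewrite diracT.
have inj : {in [set: {set 'I_L}] &, injective indicator}.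
  move=> A B _ _ AB; apply/setP => i.
  by have /(congr1 (@tnth _ _ ^~ i)) := AB; rewrite !tnth_mktuple; do 2 case: (_ \in _).
transitivity (\esum_(x in indicator @` setT) (fermi_dirac_pmf x)%:E)%E.
  rewrite [RHS]esum_mkcond; apply: eq_esum => x _.
  case: ifPn => // xi; rewrite /fermi_dirac_pmf; case: ifPn => // /andP[x01 _].
  exfalso; move/negP: xi; apply; rewrite inE; exists [set i | tnth x i == 1%N]%SET => //.
  apply: eq_from_tnth => i; rewrite tnth_mktuple inE.
  by move/all_tnthP: x01 => /(_ i); case: (tnth x i) => [|[|]].
rewrite esum_image// esum_fset//; last exact: finite_finset.
rewrite (fsbig_fwiden (index_enum {set 'I_L})) ?index_enum_uniq//; last first.
- by move=> A [_] /(_ Logic.I).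
- by move=> A _ /=; rewrite mem_index_enum.
rewrite sumEFin; congr (_%:E).
transitivity (\sum_(A : {set 'I_L} | #|A| == m) 'C(L, m)%:R^-1 : R).
  rewrite [RHS]big_mkcond /=; apply: eq_bigr => A _.
  rewrite /fermi_dirac_pmf sumn_indicator (_ : all _ _) //.
  by apply/all_tnthP => i; rewrite tnth_mktuple; case: (_ \in _).
have cardE : #|[pred A : {set 'I_L} | #|A| == m]| = 'C(L, m).
  by rewrite -cardsE card_draws card_ord.
rewrite sumr_const cardE -[LHS]mulr_natr mulVf// pnatr_eq0 -lt0n.
by rewrite bin_gt0.
Qed.

HB.instance Definition _ :=
  Measure_isProbability.Build _ _ _ fermi_dirac fermi_dirac_setT.

End fermi_dirac.
Arguments fermi_dirac_pmf R {L} m x.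
Arguments fermi_dirac {R} L m A.

Lemma fermi_dirac_set1 (R : realType) L m (x : L.-tuple nat) : (m <= L)%N ->
  fermi_dirac L m [set x] = (fermi_dirac_pmf R m x)%:E.
Proof.
by move=> mL; rewrite /fermi_dirac mL esum_set1 // lee_fin fermi_dirac_pmf_ge0.
Qed.

Section grbb.
Context {R : realType} {L : nat}.
Implicit Types (xi b : L.-tuple nat) (q : {measure set nat -> \bar R}).

Definition empirical_measure xi : {measure set nat -> \bar R} :=
  mscale (L%:R^-1)%:nng (msum (fun k => \d_(nth 0%N xi k)) L).

Definition occupied xi : L.-tuple nat := [tuple (0 < tnth xi i)%N : nat | i < L].

(* xi - w(xi) + b; the truncated subtraction is exact since w(xi) <= xi. *)
Definition grbb_step xi b : L.-tuple nat :=
  [tuple (tnth xi i - tnth (occupied xi) i + tnth b i)%N | i < L].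

HB.instance Definition _ xi := isMeasurableFun.Build _ _ _ _ (grbb_step xi)
  (measurable_fun_config (grbb_step xi)).

(* B q is the law of the random vector B^{L,q}. *)
Definition grbb (B : {measure set nat -> \bar R} -> probability (L.-tuple nat) R)
    xi : {measure set (L.-tuple nat) -> \bar R} :=
  distribution (B (empirical_measure xi)) (grbb_step xi).

Section grbb_kernel.
Variable B : {measure set nat -> \bar R} -> probability (L.-tuple nat) R.

Let measurable_grbb A : measurable A ->
  measurable_fun [set: L.-tuple nat] (grbb B ^~ A).
Proof. by move=> _; exact: measurable_fun_config. Qed.

HB.instance Definition _ := isKernel.Build _ _ _ _ _ (grbb B) measurable_grbb.

Let grbb_prob xi : grbb B xi [set: _] = 1%E.
Proof. exact: probability_setT. Qed.

HB.instance Definition _ :=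
  Kernel_isProbability.Build _ _ _ _ _ (grbb B) grbb_prob.

End grbb_kernel.

(* The number (1 - q({0})) L of particles is a natural number whenever q is
   the empirical measure of a configuration: see fermi_dirac_noiseE. *)
Definition fermi_dirac_noise q : probability (L.-tuple nat) R :=
  fermi_dirac L (Num.truncn ((1 - fine (q [set 0%N])) * L%:R)).

Lemma empirical_measure0 xi : (0 < L)%N ->
  (1 - fine (empirical_measure xi [set 0%N])) * L%:R =
  (count (fun k => 0 < k)%N xi)%:R.
Proof.
move=> L0; have L0' : L%:R != 0 :> R by rewrite pnatr_eq0 -lt0n.
rewrite /empirical_measure /= /mscale /= /msum.
have -> : (\sum_(k < L) \d_(nth 0%N xi k) [set 0%N] =
    (count (fun k => k == 0)%N xi)%:R%:E :> \bar R)%E.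
  rewrite -sum1_count big_tuple natr_sum -sumEFin [RHS]big_mkcond /=.
  apply: eq_bigr => i _; rewrite diracE -tnth_nth.
  by case: eqP => [->|x0]; [rewrite mem_set|rewrite memNset].
rewrite -EFinM /= mulrBl mul1r mulrAC mulVf// mul1r.
rewrite -{1}(size_tuple xi) -(count_predC (fun k => k == 0%N) xi) natrD.
rewrite addrAC subrr add0r; congr (_%:R).
by apply: eq_count => k /=; rewrite lt0n.
Qed.

Lemma fermi_dirac_noiseE xi : (0 < L)%N ->
  fermi_dirac_noise (empirical_measure xi) =
  fermi_dirac L (count (fun k => 0 < k)%N xi).
Proof. by move=> L0; rewrite /fermi_dirac_noise empirical_measure0// natrK. Qed.

End grbb.

(* Main.v *)
Require Import Defs.
From HB Require Import structures.
From mathcomp Require Import all_boot all_order all_algebra.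
From mathcomp Require Import all_classical all_reals all_analysis.
From mathcomp Require Import measurable_realfun.
From mathcomp Require Import ring lra zify.

(** The proof is a regeneration argument combined with a Lyapunov function.

    If every site carries at most one particle, one step removes all [N] particles
    and throws them again with Fermi-Dirac statistics: whatever the current
    configuration, the next one has exactly the law [fermi_dirac L N]
    ([grbb_regenerates]). This law is therefore invariant, and the distance to it at
    time [t.+1] is at most the probability that some site is still multiply occupied
    at time [t] ([next_law_le]).

    To bound that probability, consider the excess [e] of a configuration, that is,
    [N] minus its number [M] of occupied sites. Each occupied site loses its top
    particle and each site receives at most one, so [e] never increases. If [e > 0],
    pick a site with at least two particles: it receives none with probability
    [1 - M / L], and then [e] decreases. With [M = N - e], the potential
    [V e = \sum_(1 <= k <= e) L / (L - N + k)] thus decreases by at least 1 on average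
    while [e > 0] ([grbb_drift]). The mean number of steps with [e > 0] is then at
    most [v = V (N - 1)], because [e <= N - 1] initially; as [e] stays 0 once it is 0,
    the probability that [e > 0] at time [t] is at most [v / t.+1] ([bad_mass_le]).

    This gives a distance of at most [v / t.+1] at time [t.+1], for any law sequence
    of the chain carried by configurations with [N] particles. Applied to the kernel
    powers it gives convergence; applied to an invariant law it gives uniqueness;
    applied to the process it bounds the mixing time by the least integer above [4 * v],
    hence by [4 * v + 1], where [v <= 2 - L ln (1 - (N - 1) / L)] by comparison of the sum
    with an integral ([potential_bound]). *)

Set Implicit Arguments.
Unset Strict Implicit.
Unset Printing Implicit Defensive.

Import Order.TTheory GRing.Theory Num.Theory.
Import numFieldNormedType.Exports.

Local Open Scope classical_set_scope.
Local Open Scope ring_scope.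

(** * Chains that regenerate outside a set left at a linear rate *)

Section kernel_law.
Context d (S : measurableType d) (R : realType).
Variables (K : R.-pker S ~> S) (x : S).

(** The law [K x] as a bare set function: the key to which its structure of
    probability measure is attached. *)
Definition kernel_law : set S -> \bar R := K x.

HB.instance Definition _ := Measure.copy kernel_law (K x).
HB.instance Definition _ :=
  Measure_isProbability.Build _ _ _ kernel_law (prob_kernel x).

End kernel_law.

Section regeneration.
Context d (S : measurableType d) (R : realType) (K : R.-pker S ~> S).
Local Open Scope ereal_scope.

Definition next_law (mu nu : {measure set S -> \bar R}) : Prop :=
  forall A, measurable A -> nu A = \int[mu]_x K x A.

(** Only the values [nu A] are assumed to be integrals against [mu]; [nu] is
    therefore identified with the composition of the constant kernel [mu] with [K],
    for which the disintegration of integrals is known. *)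
Lemma ge0_integral_next_law (mu nu : probability S R) (f : S -> \bar R) :
  next_law mu nu -> measurable_fun setT f -> (forall x, 0 <= f x) ->
  \int[nu]_x f x = \int[mu]_x \int[K x]_y f y.
Proof.
move=> munu mf f0.
pose l := kprobability (@measurable_cst _ _ S (pprobability S R) setT mu).
rewrite (@eq_measure_integral _ _ _ _ (kcomp l (kernel.kernel_snd K) point)).
  by rewrite integral_kcomp.
by move=> A mA _; rewrite munu.
Qed.

Lemma integral_cst_probability (mu : probability S R) (c : \bar R) :
  \int[mu]_x c = c.
Proof. by rewrite -[RHS]mule1 -(@probability_setT _ _ _ mu) -integral_cst. Qed.

Lemma ae_mem (mu : probability S R) (E : set S) :
  measurable E -> mu E = 1 -> {ae mu, forall x, E x}.
Proof.
move=> mE muE; exists (~` E); split=> //; first exact: measurableC.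
by rewrite probability_setC// muE subee.
Qed.

(** The abstract situation: on [E], which is closed under the dynamics, one step
    from a state outside the bad set [B] lands exactly on [pi], and [V] is a
    Lyapunov function, bounded by [v] on [E], that loses at least 1 on average per
    step taken from [B]. The total time spent in [B] then has mean at most [v]. *)
Variables (E B : set S) (pi : probability S R) (V : S -> \bar R) (v : R).
Hypothesis mS : forall A : set S, measurable A.
Hypothesis V0 : forall x, 0 <= V x.
Hypothesis V_le : forall x, E x -> V x <= v%:E.
Hypothesis K_closed : forall x, E x -> K x E = 1.
Hypothesis K_regen :
  forall x, E x -> ~ B x -> forall A, K x A = pi A.
Hypothesis K_drift :
  forall x, E x -> \int[K x]_y V y + (\1_B x)%:E <= V x.
Hypotheses (piE : pi E = 1) (piB : pi B = 0).

Let mK A : measurable_fun setT (K ^~ A).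
Proof. exact: measurable_kernel. Qed.

Let mE : measurable E. Proof. exact: mS. Qed.
Let mB : measurable B. Proof. exact: mS. Qed.

Let mV : measurable_fun setT V.
Proof. by move=> _ U _; exact: mS. Qed.

Let mind : measurable_fun setT (fun x => (\1_B x)%:E : \bar R).
Proof. by apply/measurable_EFinP; exact: measurable_indic. Qed.

Lemma next_law_closed (mu nu : probability S R) :
  next_law mu nu -> mu E = 1 -> nu E = 1.
Proof.
move=> munu muE; rewrite munu//.
rewrite (@ge0_ae_eq_integral _ _ _ mu setT _ (cst 1))//.
- exact: integral_cst_probability.
- by have := ae_mem mE muE; apply: filterS => x Ex _; exact: K_closed.
Qed.

(** A step from a good state has law [pi]; one from a bad state contributes at most
    its mass. *)
Lemma next_law_le (mu nu : probability S R) A : next_law mu nu -> mu E = 1 ->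
  nu A <= pi A + mu B.
Proof.
move=> munu muE; have mA := mS A; rewrite munu//.
apply: (@le_trans _ _ (\int[mu]_x (pi A + (\1_B x)%:E))).
  apply: ae_ge0_le_integral => //.
  - by move=> x _; rewrite adde_ge0// lee_fin.
  - have := ae_mem mE muE; apply: filterS => x Ex _.
    have [Bx|nBx] := pselect (B x); last by rewrite K_regen// leeDl// lee_fin.
    rewrite indicE mem_set//= -(prob_kernel (s := K) x) -[leLHS]add0e leeD//.
    by rewrite le_measure ?inE.
rewrite ge0_integralD//.
by rewrite integral_cst_probability integral_indic// setIT.
Qed.

Lemma next_law_drift (mu nu : probability S R) :
  next_law mu nu -> mu E = 1 ->
  \int[nu]_x V x + mu B <= \int[mu]_x V x.
Proof.
move=> munu muE.
have mKV : measurable_fun setT (fun x => \int[K x]_y V y).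
  by apply: measurable_fun_integral_kernel => // U mU; exact: mK.
have KV0 x : 0 <= \int[K x]_y V y by exact: integral_ge0.
rewrite (ge0_integral_next_law munu)//.
rewrite -[X in _ + X](_ : \int[mu]_x (\1_B x)%:E = _); last first.
  by rewrite integral_indic// setIT.
rewrite -ge0_integralD//.
apply: ae_ge0_le_integral => //.
- by move=> x _; rewrite adde_ge0// lee_fin.
- by have := ae_mem mE muE; apply: filterS => x Ex _; exact: K_drift.
Qed.

(** The bounds below are proved for any sequence of laws that follow each other
    under [K], so that they apply to the powers of the kernel, to the marginals of
    a Markov process, and to the constant sequence of an invariant law. *)
Section law_sequence.
Variable mu : nat -> probability S R.
Hypothesis mu_next : forall t, next_law (mu t) (mu t.+1).
Hypothesis mu0E : mu 0%N E = 1.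

Let muE t : mu t E = 1.
Proof. by elim: t => // t IH; exact: next_law_closed (mu_next t) IH. Qed.

(** Summing the drift inequality over time bounds the sum of the bad masses
    [mu s B], [s <= t], by [v]. As [pi B = 0], good states have no bad successor and
    these masses are nonincreasing, so the last of the [t.+1] terms is at most
    their average. The induction carries the integral of [V] along. *)
Lemma bad_mass_le t : t.+1%:R%:E * mu t B <= v%:E.
Proof.
have intV0 s : 0 <= \int[mu s]_x V x by exact: integral_ge0.
suff : \int[mu t.+1]_x V x + t.+1%:R%:E * mu t B <= v%:E.
  by apply: le_trans; rewrite leeDr.
elim: t => [|t IH].
  rewrite mul1e (le_trans (next_law_drift (mu_next _) (muE _)))//.
  apply: (@le_trans _ _ (\int[mu 0%N]_x v%:E)).
    have v0 : (0 <= v)%R.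
      have [x Ex] : E !=set0.
        by apply/set0P/eqP => E0; move: mu0E; rewrite E0 measure0 => /eqP;
           rewrite eq_sym onee_eq0.
      by rewrite -lee_fin (le_trans (V0 x))// V_le.
    apply: ae_ge0_le_integral => //.
    by have := ae_mem mE (muE 0%N); apply: filterS => x Ex _; exact: V_le.
  by rewrite integral_cst_probability.
apply: le_trans IH.
rewrite (_ : t.+2%:R = 1 + t.+1%:R :> R)%R; last by rewrite -[t.+2]add1n natrD.
rewrite EFinD muleDl ?fin_num_measure// mul1e addeA leeD//.
  exact: next_law_drift.
rewrite lee_pmul2l// ?lte_fin//.
by have := next_law_le B (mu_next t) (muE t); rewrite piB add0e.
Qed.

Lemma law_le t A :
  (fine (mu t.+1 A) <= fine (pi A) + v / t.+1%:R)%R.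
Proof.
have mA := mS A; rewrite -lee_fin EFinD !fineK ?fin_num_measure//.
apply: le_trans (next_law_le A (mu_next t) (muE t)) _.
rewrite leeD2l// mulrC EFinM lee_pdivlMl//.
exact: bad_mass_le.
Qed.

Lemma tv_dist_law_le t :
  (0 <= tv_dist (mu t.+1) pi <= v / t.+1%:R)%R.
Proof.
have tv0 : [set (fine (mu t.+1 A) - fine (pi A))%R | A in [set: set S]] 0%R.
  by exists set0 => //; rewrite !measure0 subrr.
have ub : ubound [set (fine (mu t.+1 A) - fine (pi A))%R | A in [set: set S]]
    (v / t.+1%:R)%R.
  by move=> _ [A _ <-]; rewrite lerBlDl law_le.
apply/andP; split; last by apply: ge_sup => //; exists 0%R.
by apply: ub_le_sup => //; exists (v / t.+1%:R)%R.
Qed.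

End law_sequence.

Lemma regeneration_invariant : invariant_on K E pi.
Proof.
split=> // A mA.
have nB : {ae pi, forall x, ~ B x} by exists B; split=> // x /contrapT.
rewrite (@ge0_ae_eq_integral _ _ _ pi setT _ (cst (pi A)))//.
- exact: integral_cst_probability.
- have := ae_mem mE piE; move: nB; apply: filterS2 => x nBx Ex _.
  exact: K_regen.
Qed.

(** For uniqueness, an invariant law is a constant law sequence, so the bound
    [v / t.+1] between it and [pi] holds for all [t]. It is an upper bound for the
    signed difference on every event; complements give equality. *)
Lemma regeneration_ergodic : ergodic_on K E.
Proof.
have v_harmonic : (v / t.+1%:R)%R @[t --> \oo] --> 0%R.
  by rewrite -(mulr0 v); apply: cvgMr; exact: cvg_harmonic.
exists pi; split; first exact: regeneration_invariant.
- move=> pi' [pi'E pi'inv].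
  have le_pi A : (fine (pi' A) <= fine (pi A))%R.
    rewrite -[leRHS]addr0.
    have bound_cvg : (fine (pi A) + v / t.+1%:R)%R @[t --> \oo] -->
        (fine (pi A) + 0)%R by apply: cvgD => //; exact: cvg_cst.
    apply: (cvgr_to_ge bound_cvg).
    apply: nearW => t.
    by apply: (@law_le (fun=> pi')) => // _ C mC; rewrite pi'inv.
  move=> A mA; rewrite -(@fineK _ (pi' A)) ?fin_num_measure//.
  rewrite -(@fineK _ (pi A)) ?fin_num_measure//; congr (_%:E).
  apply/eqP; rewrite eq_le le_pi/=.
  have := le_pi (~` A); rewrite !probability_setC// !fineB ?fin_num_measure//.
  by rewrite lerD2l lerN2.
- move=> x Ex; rewrite -(cvg_shiftS (fun t => tv_dist (kernel_power K t x) pi)).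
  apply: (@squeeze_cvgr _ _ _ _ (cst 0%R) (fun t => v / t.+1%:R)%R) => //.
    apply: nearW => t.
    apply: (@tv_dist_law_le (fun t => kernel_law (kernel_power K t) x)) => //.
    by rewrite -[LHS]/(\d_x E) diracE mem_set.
  exact: cvg_cst.
Qed.

End regeneration.

(** * One-time marginals of a Markov process on configurations *)

Section chain_laws.
Context d (Omega : measurableType d) (R : realType) (P : probability Omega R).
Variable L : nat.
Local Open Scope ereal_scope.

(** Configurations are countable, hence enumerated by their codes; some codes are
    unused, so a fiber is either empty or a singleton. *)
Definition code_fiber n : set (L.-tuple nat) := [set x | pickle x = n].

Lemma bigcup_code_fiber (X : Omega -> L.-tuple nat) :
  \bigcup_n X @^-1` code_fiber n = setT.
Proof. by apply/seteqP; split=> // w _; exists (pickle (X w)). Qed.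

Lemma trivIset_code_fiber (X : Omega -> L.-tuple nat) :
  trivIset setT (fun n => X @^-1` code_fiber n).
Proof. by move=> i j _ _ [w [<- <-]]. Qed.

Lemma code_fiberP n : code_fiber n = set0 \/ exists y, code_fiber n = [set y].
Proof.
have [[y yn]|nE] := pselect (code_fiber n !=set0).
  right; exists y; apply/seteqP; split=> [x xn|x -> //].
  by apply: (pcan_inj (@pickleK _)); rewrite xn yn.
by left; apply/eqP; apply: contrapT => /negP/set0P.
Qed.

Lemma RV_measurable (X : {RV P >-> L.-tuple nat}) (A : set (L.-tuple nat)) :
  measurable (X @^-1` A).
Proof. exact: measurable_funPTI (measurable_config A). Qed.

Lemma probability_code_fiber (X : {RV P >-> L.-tuple nat}) (C : set Omega) :
  measurable C -> P C = \sum_(n <oo) P (C `&` X @^-1` code_fiber n).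
Proof.
move=> mC; rewrite -[C in LHS]setIT -(bigcup_code_fiber X) setI_bigcupr.
rewrite measure_semi_bigcup//.
- by move=> n; apply: measurableI => //; exact: RV_measurable.
- by apply: trivIset_setIl; exact: trivIset_code_fiber.
- apply: bigcup_measurable => n _.
  by apply: measurableI => //; exact: RV_measurable.
Qed.

Lemma total_probability (X : {RV P >-> L.-tuple nat}) (C D : set Omega)
    (k : R) : measurable C -> measurable D ->
  (forall y, P (C `&` X @^-1` [set y]) = P (D `&` X @^-1` [set y]) * k%:E) ->
  P C = P D * k%:E.
Proof.
move=> mC mD CD.
rewrite (probability_code_fiber X mC) (probability_code_fiber X mD).
rewrite muleC -nneseriesZl//.
apply: eq_eseriesr => n _; rewrite muleC.
have [->|[y ->]] := code_fiberP n; last exact: CD.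
by rewrite preimage_set0 !setI0 measure0 mul0e.
Qed.

Variables (K : R.-pker (L.-tuple nat) ~> (L.-tuple nat)).
Variable X : nat -> {RV P >-> L.-tuple nat}.
Hypothesis X_chain : markov_chain P K X.

Let window (s t : nat) (h : nat -> L.-tuple nat) : set Omega :=
  [set w | forall r, (s <= r <= t)%N -> X r w = h r].

Let measurable_window s t h : measurable (window s t h).
Proof.
have -> : window s t h = \bigcap_(r in [set r | (s <= r <= t)%N])
    (X r @^-1` [set h r]) by [].
by apply: bigcap_measurableType => // r _; exact: RV_measurable.
Qed.

Let K_fin y A : K y A \is a fin_num.
Proof. exact: (fin_num_measure (kernel_law K y) _ (measurable_config A)). Qed.

(** The Markov property given a full history [0..t] passes to histories over a
    window [s..t] by summing over the value at the earliest time, one at a time.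
    For [s = t] only the present is conditioned on. *)
Lemma markov_window s t h A : (s <= t)%N ->
  P (window s t h `&` X t.+1 @^-1` A) = P (window s t h) * K (h t) A.
Proof.
elim: s h => [|s IH] h st.
  have -> : window 0 t h = [set w | forall r, (r <= t)%N -> X r w = h r] by [].
  exact: X_chain.
rewrite -(fineK (K_fin (h t) A)); apply: (@total_probability (X s)) => //.
  by apply: measurableI => //; exact: RV_measurable.
move=> y; pose h' r := if r == s then y else h r.
have h't : h' t = h t by rewrite /h' gtn_eqF.
have windowE : window s.+1 t h `&` X s @^-1` [set y] = window s t h'.
  apply/seteqP; split=> w.
    move=> [hw ys] r /andP[sr rt]; rewrite /h'; case: eqP => [-> //|/eqP rs].
    by apply: hw; rewrite ltn_neqAle eq_sym rs sr.
  move=> hw; split.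
    move=> r /andP[sr rt]; rewrite hw ?(ltnW sr)//.
    by rewrite /h' gtn_eqF.
  by rewrite /preimage/= hw ?leqnn ?(ltnW st)// /h' eqxx.
by rewrite setIAC windowE IH ?(ltnW st)// h't fineK.
Qed.

Lemma markov_chain_next_law t :
  next_law K (distribution P (X t)) (distribution P (X t.+1)).
Proof.
move=> A mA; rewrite ge0_integral_distribution//; last exact: measurable_kernel.
have mcode n : measurable (X t @^-1` code_fiber n) by exact: RV_measurable.
have mKX : measurable_fun setT (fun w => K (X t w) A).
  exact: measurableT_comp (measurable_kernel K A mA) _.
rewrite -[X in integral _ X _](bigcup_code_fiber (X t)).
rewrite ge0_integral_bigcup//; last 2 first.
- exact: measurable_funS mKX.
- exact: trivIset_code_fiber.
rewrite -[LHS]/(P (X t.+1 @^-1` A)).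
rewrite (probability_code_fiber (X t)); last exact: RV_measurable.
apply: eq_eseriesr => n _.
have [->|[y ->]] := code_fiberP n.
  by rewrite preimage_set0 setI0 measure0 integral_set0.
rewrite (eq_integral (cst (K y A))); last first.
  by move=> w; rewrite inE => /= ->.
rewrite integral_cst//; last exact: RV_measurable.
rewrite setIC muleC.
have := @markov_window t t (fun=> y) A (leqnn t).
rewrite (_ : window t t (fun=> y) = X t @^-1` [set y])//.
apply/seteqP; split=> w; first by apply; rewrite leqnn.
by move=> wy r; rewrite -eqn_leq => /eqP <-.
Qed.

End chain_laws.

(** * Fermi-Dirac statistics as uniform random subsets *)

Section fermi_dirac_counting.
Context (R : realType) (L m : nat).
Hypothesis mL : (m <= L)%N.

Definition indicator (T : {set 'I_L}) : L.-tuple nat :=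
  [tuple (i \in T : nat) | i < L].

Lemma indicator_inj : injective indicator.
Proof.
move=> T U TU; apply/setP => i.
have /(congr1 (@tnth _ _ ^~ i)) := TU; rewrite !tnth_mktuple.
by case: (i \in T); case: (i \in U).
Qed.

Lemma sumn_indicator (T : {set 'I_L}) : sumn (indicator T) = #|T|.
Proof.
rewrite sumnE big_tuple -sum1_card [RHS]big_mkcond /=.
by apply: eq_bigr => i _; rewrite tnth_mktuple; case: (i \in T).
Qed.

Lemma all_indicator (T : {set 'I_L}) : all (fun k => k <= 1)%N (indicator T).
Proof. by apply/all_tnthP => i; rewrite tnth_mktuple; case: (_ \in _). Qed.

Lemma indicator_surj (x : L.-tuple nat) :
  all (fun k => k <= 1)%N x -> exists T, indicator T = x.
Proof.
move/all_tnthP => x01; exists [set i | tnth x i == 1%N]%SET.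
apply: eq_from_tnth => i; rewrite tnth_mktuple inE.
by move: (x01 i); case: (tnth x i) => [|[|]].
Qed.

(** Parametrizing the support by the set of occupied sites turns the sum over all
    configurations into a finite one. *)
Lemma fermi_diracE (A : set (L.-tuple nat)) :
  fermi_dirac L m A =
  (\sum_(T : {set 'I_L} | (#|T| == m) && (indicator T \in A))
     'C(L, m)%:R^-1 : R)%:E.
Proof.
rewrite /fermi_dirac mL.
pose F x : \bar R := if x \in A then (fermi_dirac_pmf R m x)%:E else 0%E.
have F0 x : (0 <= F x)%E.
  by rewrite /F; case: ifP => // _; rewrite lee_fin fermi_dirac_pmf_ge0.
transitivity (\esum_(x in indicator @` setT) F x).
  rewrite esum_mkcond [RHS]esum_mkcond; apply: eq_esum => x _.
  rewrite -/(F x); case: ifPn => // xi.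
  rewrite /F /fermi_dirac_pmf; case: ifPn => // _; case: ifPn => // /andP[x01 _].
  exfalso; move/negP: xi; apply; rewrite inE.
  by have [T <-] := indicator_surj x01; exists T.
rewrite esum_image//; last by move=> T U _ _; exact: indicator_inj.
rewrite esum_fset//; last exact: finite_finset.
rewrite (fsbig_fwiden (index_enum {set 'I_L})) ?index_enum_uniq//; last first.
- by move=> T [_] /(_ Logic.I).
- by move=> T _ /=; rewrite mem_index_enum.
rewrite [in RHS]big_mkcond -sumEFin/=; apply: eq_bigr => T _.
rewrite /F /fermi_dirac_pmf sumn_indicator all_indicator/=.
by case: (_ \in _); case: (_ == _).
Qed.

Definition exclusion_config : set (L.-tuple nat) :=
  [set x | all (fun k => k <= 1)%N x && (sumn x == m)].

Lemma fermi_dirac_exclusion : fermi_dirac (R := R) L m exclusion_config = 1%E.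
Proof.
transitivity (fermi_dirac (R := R) L m setT); last first.
  exact: (@probability_setT _ _ _ (fermi_dirac (R := R) L m)).
rewrite !fermi_diracE; congr (_%:E); apply: eq_bigl => T.
case: eqP => //= Tm; rewrite !mem_set//=.
by rewrite /exclusion_config/= all_indicator sumn_indicator Tm eqxx.
Qed.

(** The [m]-subsets that avoid a given site number ['C(L.-1, m)]. *)
Lemma fermi_dirac_empty_site (x : 'I_L) :
  fermi_dirac L m [set b | tnth b x = 0%N] = (1 - m%:R / L%:R : R)%:E.
Proof.
have L0 : (0 < L)%N := leq_ltn_trans (leq0n x) (ltn_ord x).
rewrite fermi_diracE; congr (_%:E).
rewrite (eq_bigl (fun T => T \in
  [set T : {set 'I_L} | T \subset (~: [set x])%SET & #|T| == m]%SET)); last first.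
  move=> T; rewrite inE andbC; congr (_ && _).
  rewrite finset.subsetC finset.sub1set inE; apply/idP/idP => [|xT].
    by rewrite inE/= tnth_mktuple; case: (_ \in _).
  by rewrite inE/= tnth_mktuple (negbTE xT).
rewrite sumr_const cards_draws cardsC1 card_ord -[LHS]mulr_natl.
have CL : 'C(L, m)%:R != 0 :> R by rewrite pnatr_eq0 -lt0n bin_gt0.
have LR : L%:R != 0 :> R by rewrite pnatr_eq0 -lt0n.
apply: (mulfI LR); apply: (mulIf CL); rewrite mulrA mulfVK//.
rewrite -natrM mul_bin_down natrM natrB//.
by rewrite mulrBr mulr1 [L%:R * _]mulrC mulfVK.
Qed.

End fermi_dirac_counting.

(** * Excess of a configuration and its drift *)

Section excess.
Variable L : nat.
Implicit Types xi b : L.-tuple nat.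

(** The number of particles that are not the top one of their site. *)
Definition excess xi : nat := \sum_(i < L) (tnth xi i).-1.

Definition occupation xi : nat := count (fun k => 0 < k)%N xi.

Lemma sumn_occupation_excess xi : sumn xi = (occupation xi + excess xi)%N.
Proof.
rewrite sumnE /occupation -sum1_count !big_tuple.
rewrite [X in (X + _)%N]big_mkcond -big_split/=.
by apply: eq_bigr => i _; case: (tnth xi i).
Qed.

Lemma tnth_grbb_step xi b i :
  tnth (grbb_step xi b) i = ((tnth xi i).-1 + tnth b i)%N.
Proof. by rewrite !tnth_mktuple; case: (tnth xi i) => //= n; rewrite subn1. Qed.

Lemma sumn_grbb_step xi b : sumn b = occupation xi ->
  sumn (grbb_step xi b) = sumn xi.
Proof.
move=> bxi; rewrite (sumn_occupation_excess xi) -bxi !sumnE !big_tuple addnC.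
by rewrite -big_split/=; apply: eq_bigr => i _; rewrite tnth_grbb_step.
Qed.

Lemma grbb_step_no_excess xi b : excess xi = 0%N -> grbb_step xi b = b.
Proof.
move=> /eqP; rewrite sum_nat_eq0 => /forallP xi1; apply: eq_from_tnth => i.
by rewrite tnth_grbb_step (eqP (xi1 i)).
Qed.

Let step_site_le xi b i : all (fun k => k <= 1)%N b ->
  ((tnth (grbb_step xi b) i).-1 <= (tnth xi i).-1)%N.
Proof.
move=> /all_tnthP/(_ i); rewrite tnth_grbb_step.
by case: (tnth b i) => [|[|//]] _; rewrite ?addn0 ?addn1// leq_pred.
Qed.

Lemma excess_grbb_step_le xi b : all (fun k => k <= 1)%N b ->
  (excess (grbb_step xi b) <= excess xi)%N.
Proof. by move=> b01; apply: leq_sum => i _; exact: step_site_le. Qed.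

(** A site with two or more particles loses one of them. If it receives none, its
    contribution drops by 1, and no other contribution can grow. *)
Lemma excess_grbb_step_lt xi b i : all (fun k => k <= 1)%N b ->
  (1 < tnth xi i)%N -> tnth b i = 0%N ->
  (excess (grbb_step xi b) < excess xi)%N.
Proof.
move=> b01 xi_i bi; rewrite /excess (bigD1 i)//= [ltnRHS](bigD1 i)//=.
rewrite -addSn leq_add//; last by apply: leq_sum => j _; exact: step_site_le.
by rewrite tnth_grbb_step bi addn0; case: (tnth xi i) xi_i => [|[|]].
Qed.

Lemma excess_gt0 xi : (0 < excess xi)%N -> exists i, (1 < tnth xi i)%N.
Proof.
rewrite lt0n sum_nat_eq0 negb_forall => /existsP[i] xi_i; exists i.
by case: (tnth xi i) xi_i => [|[|]].
Qed.

Lemma occupation_gt0 xi : (0 < sumn xi)%N -> (0 < occupation xi)%N.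
Proof.
rewrite sumn_occupation_excess addn_gt0 => /orP[//|/excess_gt0[i xi_i]].
rewrite -has_count; apply/hasP; exists (tnth xi i); first exact: mem_tnth.
exact: ltnW xi_i.
Qed.

End excess.

Section drift.
Context (R : realType) (L N : nat).
Hypotheses (NL : (N <= L)%N) (L0 : (0 < L)%N).

(** At excess [j.+1] there are [N - j.+1] occupied sites, so a given site stays empty
    in the noise with probability [(L - N + j).+1 / L]; the summand, its inverse,
    bounds the mean time that the excess takes to go below [j.+1]. *)
Definition potential (e : nat) : R :=
  \sum_(j < e) L%:R / (L - N + j).+1%:R.

Lemma potential_ge0 e : 0 <= potential e.
Proof. by apply: sumr_ge0 => j _; rewrite divr_ge0. Qed.

Lemma potential_le e f : (e <= f)%N -> potential e <= potential f.
Proof.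
move=> /subnKC <-; elim: (f - e)%N => [|n IH]; first by rewrite addn0.
by rewrite addnS /potential big_ord_recr/= (le_trans IH)// lerDl divr_ge0.
Qed.

Let K : R.-pker (L.-tuple nat) ~> (L.-tuple nat) := grbb fermi_dirac_noise.

Lemma grbb_fermi_diracE xi A :
  K xi A = fermi_dirac L (occupation xi) (grbb_step xi @^-1` A).
Proof.
rewrite -[LHS]/(fermi_dirac_noise (empirical_measure xi) (grbb_step xi @^-1` A)).
by rewrite fermi_dirac_noiseE.
Qed.

Lemma ge0_integral_grbb xi (f : L.-tuple nat -> \bar R) :
  (forall x, 0 <= f x)%E ->
  (\int[K xi]_y f y =
   \int[fermi_dirac (R := R) L (occupation xi)]_b f (grbb_step xi b))%E.
Proof.
move=> f0; rewrite /K/= /grbb ge0_integral_distribution//.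
  by rewrite fermi_dirac_noiseE.
exact: measurable_fun_config.
Qed.

Lemma occupation_le_size (xi : L.-tuple nat) : (occupation xi <= L)%N.
Proof. by rewrite -[leqRHS](size_tuple xi) count_size. Qed.

Lemma grbb_conserves (xi : L.-tuple nat) : K xi [set x | sumn x = sumn xi] = 1%E.
Proof.
rewrite grbb_fermi_diracE; apply/eqP; rewrite eq_le.
rewrite (@probability_le1 _ _ _ (fermi_dirac (R := R) L (occupation xi))).
  rewrite -(fermi_dirac_exclusion R (occupation_le_size xi)) le_measure ?inE//.
  - exact: measurable_config.
  - exact: measurable_config.
  - by move=> b /andP[_ /eqP bxi]; exact: sumn_grbb_step.
exact: measurable_config.
Qed.

(** Without excess every particle is removed and thrown again, so the new
    configuration is the noise itself. *)
Lemma grbb_regenerates (xi : L.-tuple nat) A : sumn xi = N -> excess xi = 0%N ->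
  K xi A = fermi_dirac L N A.
Proof.
move=> xiN xi0; rewrite grbb_fermi_diracE.
have -> : occupation xi = N by rewrite -xiN sumn_occupation_excess xi0 addn0.
congr (fermi_dirac _ _ _); apply/seteqP.
by split=> b; rewrite /preimage/= grbb_step_no_excess.
Qed.

(** The bad set of the regeneration argument. *)
Definition congested : set (L.-tuple nat) := [set xi | (0 < excess xi)%N].

Lemma fermi_dirac_congested : fermi_dirac (R := R) L N congested = 0%E.
Proof.
apply/eqP; rewrite -measure_le0.
rewrite (_ : 0%E = fermi_dirac (R := R) L N (~` exclusion_config N)).
  rewrite le_measure ?inE//; try exact: measurable_config.
  move=> x xe /andP[/all_tnthP x01 _].
  by have [i] := excess_gt0 xe; rewrite ltnNge x01.
rewrite (@probability_setC _ _ _ (fermi_dirac (R := R) L N))//; last first.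
  exact: measurable_config.
by rewrite /= fermi_dirac_exclusion// subee.
Qed.

(** If there is excess, some site [i] has at least two particles. The excess never
    increases, and it decreases whenever [i] is not hit by the noise; this has
    probability [1 - occupation xi / L], the inverse of the last summand [c] of the
    potential, so the mean decrease of the potential is at least 1. *)
Lemma grbb_drift (xi : L.-tuple nat) : sumn xi = N ->
  (\int[K xi]_y (potential (excess y))%:E + (\1_congested xi)%:E
    <= (potential (excess xi))%:E)%E.
Proof.
move=> xiN; have mL := occupation_le_size xi.
rewrite ge0_integral_grbb; last by move=> y; rewrite lee_fin potential_ge0.
pose FD : probability (L.-tuple nat) R := fermi_dirac (R := R) L (occupation xi).
rewrite -/FD.
have aeFD : {ae FD, forall b, exclusion_config (occupation xi) b}.
  by apply: ae_mem; [exact: measurable_config|exact: fermi_dirac_exclusion].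
have [xi_bad|xi_good] := ltnP 0 (excess xi); last first.
  rewrite indicE memNset//= ?adde0; last by rewrite /congested/= ltnNge xi_good.
  rewrite -[leRHS](integral_cst_probability FD).
  apply: ae_ge0_le_integral => //.
  - by move=> y _; rewrite lee_fin potential_ge0.
  - exact: measurable_fun_config.
  - by move=> y _; rewrite lee_fin potential_ge0.
  move: aeFD; apply: filterS => b /andP[b01 _] _.
  by rewrite lee_fin potential_le// excess_grbb_step_le.
rewrite indicE mem_set//=.
have [i xi_i] := excess_gt0 xi_bad.
pose c : R := L%:R / (L - N + (excess xi).-1).+1%:R.
have potentialS : potential (excess xi) = potential (excess xi).-1 + c.
  by rewrite -{1}(prednK xi_bad) /potential big_ord_recr.
have c0 : 0 <= c by rewrite divr_ge0.
pose empty_site := [set b : L.-tuple nat | tnth b i = 0%N].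
apply: (@le_trans _ _ (\int[FD]_b ((potential (excess xi).-1)%:E +
    c%:E * (\1_(~` empty_site) b)%:E) + 1%:E)%E).
  rewrite leeD2r//; apply: ae_ge0_le_integral => //.
  - by move=> y _; rewrite lee_fin potential_ge0.
  - exact: measurable_fun_config.
  - by move=> y _; rewrite -EFinM -EFinD lee_fin addr_ge0 ?potential_ge0//
      mulr_ge0.
  - exact: measurable_fun_config.
  move: aeFD; apply: filterS => b /andP[b01 _] _; rewrite -EFinM -EFinD lee_fin.
  have [bi|bi] := pselect (empty_site b).
    rewrite indicE memNset//= mulr0 addr0 potential_le//.
    by rewrite -ltnS prednK// (excess_grbb_step_lt b01 xi_i bi).
  rewrite indicE mem_set//= mulr1 -potentialS potential_le//.
  exact: excess_grbb_step_le.
rewrite ge0_integralD//; try exact: measurable_fun_config; last 2 first.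
- by move=> y _; rewrite lee_fin potential_ge0.
- by move=> y _; rewrite -EFinM lee_fin mulr_ge0.
rewrite integral_cst_probability ge0_integralZl//; last first.
  exact: measurable_fun_config.
rewrite integral_indic ?setIT//; try exact: measurable_config.
have empty_siteC : FD (~` empty_site) = ((occupation xi)%:R / L%:R : R)%:E.
  rewrite (@probability_setC _ _ _ FD); last exact: measurable_config.
  by rewrite /FD/= fermi_dirac_empty_site// -EFinB opprB addrCA subrr addr0.
rewrite [X in (c%:E * X)%E](_ : _ = ((occupation xi)%:R / L%:R : R)%:E)//.
rewrite -EFinM -!EFinD lee_fin potentialS.
rewrite -addrA lerD2l.
have cE : (L - N + (excess xi).-1).+1%:R = L%:R - (occupation xi)%:R :> R.
  rewrite -natrB//; congr (_%:R); rewrite -addnS prednK//.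
  by have := sumn_occupation_excess xi; rewrite xiN; lia.
have cN0 : L%:R - (occupation xi)%:R != 0 :> R by rewrite -cE.
have LN0 : L%:R != 0 :> R by rewrite pnatr_eq0 -lt0n.
rewrite le_eqVlt; apply/orP; left; apply/eqP; rewrite /c cE.
by field; rewrite cN0 LN0.
Qed.

End drift.

(** * Logarithmic bound on the potential *)

Section potential_bound.
Context (R : realType).

(** The inequality [ln (1 + x) <= x] at [x = - k.+1^-1]. *)
Lemma inv_le_ln_ratio (k : nat) : (0 < k)%N ->
  k.+1%:R^-1 <= ln (k.+1%:R / k%:R) :> R.
Proof.
move=> k0; have kR : (0 < k%:R :> R) by rewrite ltr0n.
rewrite -[_ / _]invrK lnV ?posrE ?invr_gt0 ?divr_gt0// lerNr invf_div.
have -> : k%:R / k.+1%:R = 1 + - k.+1%:R^-1 :> R.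
  by rewrite -natr1; field; rewrite natr1 pnatr_eq0.
by rewrite le_ln1Dx// ltrN2 invf_lt1// ltr1n ltnS.
Qed.

(** The first term is kept apart; the others are compared with the integral of the
    inverse function. *)
Lemma sum_inv_le_ln (a n : nat) : (0 < a)%N ->
  \sum_(j < n.+1) (a + j)%:R^-1 <= a%:R^-1 + ln ((a + n)%:R / a%:R) :> R.
Proof.
move=> a0; have aR : (0 < a%:R :> R) by rewrite ltr0n.
elim: n => [|n IH].
  by rewrite big_ord1 addn0 divff ?gt_eqF// ln1 addr0.
rewrite big_ord_recr/= addnS.
have anR : (0 < (a + n)%:R :> R) by rewrite ltr0n addn_gt0 a0.
have -> : (a + n).+1%:R / a%:R =
    ((a + n)%:R / a%:R) * ((a + n).+1%:R / (a + n)%:R) :> R.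
  by rewrite mulrACA [_ * _.+1%:R]mulrC mulrACA divff ?gt_eqF// mulr1.
rewrite lnM ?posrE ?divr_gt0// addrA lerD//.
by rewrite inv_le_ln_ratio// addn_gt0 a0.
Qed.

(** Since [2 * N <= L], the term kept apart costs at most
    [L / (L - N).+1 <= 2]. *)
Lemma potential_bound (L N : nat) : (2 <= N)%N -> (2 * N <= L)%N ->
  potential R L N N.-1 <= 2 - L%:R * ln (1 - (N%:R - 1) / L%:R).
Proof.
case: N => [|[|n]]// _ NL /=.
have L0 : (0 < L%:R :> R) by rewrite ltr0n; lia.
pose a := (L - n.+2).+1.
have a0 : (0 < a%:R :> R) by rewrite ltr0n.
have aE : a%:R = L%:R - n.+1%:R :> R.
  by rewrite -natrB; [congr _%:R; rewrite /a; lia | lia].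
have -> : 1 - (n.+2%:R - 1) / L%:R = (L%:R / a%:R)^-1 :> R.
  by rewrite aE -[n.+2%:R]natr1 addrK invf_div mulrBl divff ?gt_eqF.
rewrite lnV ?posrE ?divr_gt0// mulrN opprK /potential.
under eq_bigr do rewrite -addSn -/a.
rewrite -mulr_sumr.
apply: (@le_trans _ _ (L%:R * (a%:R^-1 + ln ((a + n)%:R / a%:R)))).
  by rewrite ler_pM2l// sum_inv_le_ln.
rewrite mulrDr lerD//.
  by rewrite ler_pdivrMr// -natrM ler_nat /a; lia.
rewrite ler_pM2l// ler_ln ?posrE ?divr_gt0// ?ltr0n//.
by rewrite ler_pM2r ?invr_gt0// ler_nat /a; lia.
Qed.

End potential_bound.

(** * Ergodicity and mixing time *)

Unset Implicit Arguments.

Theorem proposition3p2 (R : realType) (L N : nat) (d : measure_display)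
    (Omega : measurableType d) (P : probability Omega R)
    (eta : nat -> {RV P >-> L.-tuple nat}) (xi0 : L.-tuple nat)
    (eta_grbb : markov_chain P (grbb fermi_dirac_noise) eta)
    (eta0 : P [set w | eta 0%N w = xi0] = 1%E)
    (xi0N : sumn xi0 = N)
    (N_ge2 : (2 <= N)%N) (N_leL2 : N%:R <= L%:R / 2 :> R) :
  let config_N := [set xi : L.-tuple nat | sumn xi = N] in
  let K : R.-pker (L.-tuple nat) ~> (L.-tuple nat) := grbb fermi_dirac_noise in
  let pi_NL : probability (L.-tuple nat) R := fermi_dirac L N in
  [/\ ergodic_on K config_N,
      invariant_on K config_N pi_NL &
      (mixing_time P eta pi_NL <=
        (13 - 4 * L%:R * ln (1 - (N%:R - 1) / L%:R))%:E)%E].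
Proof.
move=> config_N K pi_NL.
have NL2 : (2 * N <= L)%N.
  by move: N_leL2; rewrite ler_pdivlMr// -natrM ler_nat mulnC.
have NL : (N <= L)%N by lia.
have L0 : (0 < L)%N by lia.
pose v := potential R L N N.-1.
have config1 : pi_NL config_N = 1%E.
  apply/eqP; rewrite eq_le probability_le1; last exact: measurable_config.
  rewrite -(fermi_dirac_exclusion R NL) le_measure ?inE//=;
    try exact: measurable_config.
  by move=> x /andP[_ /eqP].
(* At least one site is occupied, so the excess is at most N.-1. *)
have V_le x : config_N x -> ((potential R L N (excess x))%:E <= v%:E)%E.
  move=> xN; rewrite lee_fin potential_le//.
  have := sumn_occupation_excess x; have := @occupation_gt0 L x.
  by rewrite xN; lia.
have V0 (x : L.-tuple nat) : (0 <= (potential R L N (excess x))%:E)%E.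
  by rewrite lee_fin potential_ge0.
have K_closed x : config_N x -> K x config_N = 1%E.
  by move=> xN; rewrite -[RHS](grbb_conserves R L0 x) xN.
have K_regen x : config_N x -> ~ congested x -> forall A, K x A = pi_NL A.
  move=> xN xB A; apply: grbb_regenerates => //.
  by apply/eqP; rewrite -leqn0 leqNgt; apply/negP.
have K_drift x : config_N x -> (\int[K x]_y (potential R L N (excess y))%:E +
    (\1_(@congested L) x)%:E <= (potential R L N (excess x))%:E)%E.
  exact: grbb_drift.
have piB := fermi_dirac_congested R NL.
split.
- exact: (regeneration_ergodic (@measurable_config L) V0 V_le K_closed
    K_regen K_drift config1 piB).
- exact: (regeneration_invariant (@measurable_config L) K_regen
    config1 piB).
(* t.+1 is an integer with 4 * v < t.+1 <= 4 * v + 1. *)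
pose t := Num.truncn (4 * v).
have v0 : 0 <= v by exact: potential_ge0.
have /andP[t_le t_gt] : t%:R <= 4 * v < t.+1%:R.
  by apply: truncn_itv; rewrite mulr_ge0.
apply: (@le_trans _ _ t.+1%:R%:E); last first.
  have := potential_bound R N_ge2 NL2; rewrite -/v lee_fin -natr1; lra.
apply: ereal_inf_lbound; exists t.+1 => //=.
have eta0N : distribution P (eta 0%N) config_N = 1%E.
  apply/eqP; rewrite eq_le probability_le1; last exact: measurable_config.
  rewrite -eta0 le_measure ?inE//=; try exact: RV_measurable.
    exact: (RV_measurable (eta 0%N) [set xi0]).
  by move=> w /= ->.
have /andP[_ tv_le] := tv_dist_law_le (@measurable_config L) V0 V_le K_closed
  K_regen K_drift piB (mu := fun s => distribution P (eta s))
  (markov_chain_next_law eta_grbb) eta0N t.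
apply: le_trans tv_le _; rewrite ler_pdivrMr// mulrC ler_pdivlMr// mulrC.
exact: ltW.
Qed.
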